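(* Let $1\le r<\min\{n,m\}$, let $\mathcal{C}=\{X\in\mathbb{R}^{n\times m}:\operatorname{rank}(X)\le r\}$, and let $\widehat{X}\in\mathcal{C}$ with $\sigma_r(\widehat{X})>0$. For $X\in\mathcal{C}$ define the operator $P_X(Z)=P_{\mathcal{C}}(P_{T_X}(Z))$, where $T_X$ is the tangent space at $X$ (defined in the context). Let $\rho=\frac{\sigma_r(\widehat{X})}{4}$, $\gamma^{\mathrm{c}}=\gamma^{\mathrm{d}}=\frac{6}{\sigma_r(\widehat{X})}$ and $\phi=3$. Then: (i) (inner product condition) for any $X\in\mathcal{C}$ and $Z\in\mathbb{R}^{n\times m}$ with $X,P_X(Z)\in\mathbb{B}_2(\widehat{X},\rho)$, $$\langle\widehat{X}-P_X(Z),Z-P_X(Z)\rangle\le\max\{\|Z-P_X(Z)\|_{\mathrm{sp}},\|Z-X\|_{\mathrm{sp}}\}\cdot\left(\gamma^{\mathrm{c}}\|\widehat{X}-P_X(Z)\|_F^2+\gamma^{\mathrm{d}}\|\widehat{X}-X\|_F^2\right);$$ (ii) (norm compatibility) $\|Z-P_X(Z)\|_{\mathrm{sp}}\le\phi\|Z-X\|_{\mathrm{sp}}$ for all $X\in\mathcal{C}\cap\mathbb{B}_2(\widehat{X},\rho)$ and $Z\in\mathbb{R}^{n\times m}$; (iii) (local continuity) for every $c_0>0$: for any $X\in\mathcal{C}\cap\mathbb{B}_2(\widehat{X},\rho)$ and any $\epsilon>0$ there exists $\delta>0$ such that, for any $Z,W\in\mathbb{R}^{n\times m}$ with $P_X(Z)\in\mathbb{B}_2(\widehat{X},\rho)$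 and $2(\gamma^{\mathrm{c}}+\gamma^{\mathrm{d}})\|Z-P_X(Z)\|_{\mathrm{sp}}\le1-c_0$, if $\|Z-W\|_F\le\delta$ then $\|P_X(Z)-P_X(W)\|_F\le\epsilon$.
   Context: $\sigma_1(X)\ge\sigma_2(X)\ge\dots$ are the singular values of $X$, $\|X\|_{\mathrm{sp}}=\sigma_1(X)$, $\|\cdot\|_F$ is the Frobenius norm, $\langle\cdot,\cdot\rangle$ the trace inner product, and $\mathbb{B}_2(\widehat{X},\rho)$ the (closed) Frobenius-norm ball of radius $\rho$ around $\widehat{X}$. $P_{\mathcal{C}}(Z)\in\arg\min_{X\in\mathcal{C}}\|X-Z\|_F$ (any choice if non-unique). For a rank-$r$ matrix $X$, $T_X=\{UA^\top+BV^\top:A\in\mathbb{R}^{m\times r},B\in\mathbb{R}^{n\times r}\}$, where $U\in\mathbb{R}^{n\times r}$ and $V\in\mathbb{R}^{m\times r}$ are orthonormal bases for the column and row span of $X$; for $X\in\mathcal{C}$ of rank less than $r$, one takes $U,V$ to be any orthonormal matrices whose column spans contain the column and row span of $X$, with some choice of $T_X$ fixed for each such $X$. $P_{T_X}$ is orthogonal projection onto the subspace $T_X$: $P_{T_X}(Z)=UU^\top Z+ZVV^\top-UU^\top ZVV^\top$. *)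

(* Defs.v *)
From HB Require Import structures.
From mathcomp Require Import all_boot all_order all_algebra.
From mathcomp Require Import ring.
From mathcomp Require Import boolp classical_sets reals.
Set Implicit Arguments.
Unset Strict Implicit.
Unset Printing Implicit Defensive.
Import Order.TTheory GRing.Theory Num.Theory.
Local Open Scope ring_scope.
Local Open Scope classical_set_scope.

(* Roots of the characteristic polynomial with multiplicity, in nonincreasing
   order. The list exists, and is then unique, exactly when the polynomial
   splits over R; this is always so for the symmetric matrices X^T *m X. *)
Definition eigenvalues (R : realType) (k : nat) (A : 'M[R]_k) : seq R :=
  xget [::] [set s : seq R |
    sorted >=%R s /\ char_poly A = \prod_(a <- s) ('X - a%:P)].

(* 1-based: sing_val 1 X is the largest singular value. *)
Definition sing_val (R : realType) (n m : nat) (k : nat) (X : 'M[R]_(n, m)) : R :=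
  Num.sqrt (nth 0 (eigenvalues (X^T *m X)) k.-1).

Definition sp_norm (R : realType) (n m : nat) (X : 'M[R]_(n, m)) : R :=
  sing_val 1 X.

Definition inner (R : realType) (n m : nat) (A B : 'M[R]_(n, m)) : R :=
  \tr (A^T *m B).

Definition frob_norm (R : realType) (n m : nat) (A : 'M[R]_(n, m)) : R :=
  Num.sqrt (inner A A).

Definition frob_ball (R : realType) (n m : nat) (X0 : 'M[R]_(n, m)) (rho : R) :
    set 'M[R]_(n, m) :=
  [set X | frob_norm (X - X0) <= rho].

Definition rank_le (R : realType) (n m : nat) (r : nat) : set 'M[R]_(n, m) :=
  [set X | (\rank X <= r)%N].

Definition is_nearest_point (R : realType) (n m : nat) (C : set 'M[R]_(n, m))
    (Z Y : 'M[R]_(n, m)) : Prop :=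
  C Y /\ forall X, C X -> frob_norm (Y - Z) <= frob_norm (X - Z).

Definition tangent_set (R : realType) (n m r : nat)
    (U : 'M[R]_(n, r)) (V : 'M[R]_(m, r)) : set 'M[R]_(n, m) :=
  [set Y | exists (A : 'M[R]_(m, r)) (B : 'M[R]_(n, r)),
    Y = U *m A^T + B *m V^T].

(* The two inclusions say that the column (resp. row) span of X lies in the
   column span of U (resp. V). If \rank X = r they are equalities, by
   dimension: U and V are then orthonormal bases of these spans. *)
Definition is_tangent_space (R : realType) (n m r : nat) (X : 'M[R]_(n, m))
    (T : set 'M[R]_(n, m)) : Prop :=
  exists (U : 'M[R]_(n, r)) (V : 'M[R]_(m, r)),
    [/\ U^T *m U = 1%:M, V^T *m V = 1%:M,
        (X^T <= U^T)%MS, (X <= V^T)%MS & T = tangent_set U V].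

Definition orth_proj (R : realType) (n m : nat) (T : set 'M[R]_(n, m))
    (Z : 'M[R]_(n, m)) : 'M[R]_(n, m) :=
  xget 0 [set Y | T Y /\ forall W, T W -> inner (Z - Y) W = 0].

Lemma inner_eq0 (R : realType) (n m : nat) (A : 'M[R]_(n, m)) :
  inner A A = 0 -> A = 0.
Proof.
rewrite /inner /mxtrace => h; apply/matrixP => i j; rewrite mxE.
have hge (k : 'I_m) : true -> 0 <= (A^T *m A) k k.
  by move=> _; rewrite mxE sumr_ge0 // => l _; rewrite mxE -expr2 sqr_ge0.
have /(_ j isT) := psumr_eq0P hge h.
rewrite mxE => h2.
have hge2 (l : 'I_n) : true -> 0 <= A^T j l * A l j.
  by move=> _; rewrite mxE -expr2 sqr_ge0.
have /(_ i isT) := psumr_eq0P hge2 h2.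
by rewrite mxE => /eqP; rewrite -expr2 sqrf_eq0 => /eqP.
Qed.

Lemma orth_proj_tangent (R : realType) (n m r : nat)
    (U : 'M[R]_(n, r)) (V : 'M[R]_(m, r)) (Z : 'M[R]_(n, m)) :
  U^T *m U = 1%:M -> V^T *m V = 1%:M ->
  orth_proj (tangent_set U V) Z =
    U *m U^T *m Z + Z *m V *m V^T - U *m U^T *m Z *m V *m V^T.
Proof.
move=> hU hV; set P := RHS.
have TP : tangent_set U V P.
  exists (Z^T *m U), (Z *m V - U *m U^T *m Z *m V).
  by rewrite trmx_mul trmxK mulmxBl !mulmxA addrA.
have e : Z - P = (1%:M - U *m U^T) *m Z *m (1%:M - V *m V^T).
  rewrite /P !mulmxBl !mulmxBr !mulmx1 !mul1mx !mulmxA.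
  by rewrite !opprB !opprD !addrA; apply/matrixP => i j; rewrite !mxE; ring.
have oP W : tangent_set U V W -> inner (Z - P) W = 0.
  case=> A [B ->]; rewrite /inner e.
  have hl : (1%:M - U *m U^T) *m U = 0.
    by rewrite mulmxBl mul1mx -mulmxA hU mulmx1 subrr.
  have hr : V^T *m (1%:M - V *m V^T) = 0.
    by rewrite mulmxBr mulmx1 mulmxA hV mul1mx subrr.
  have eT k (Q : 'M[R]_(k, r)) : (1%:M - Q *m Q^T)^T = 1%:M - Q *m Q^T.
    by rewrite linearB /= trmx1 trmx_mul trmxK.
  rewrite !trmx_mul !eT mulmxDr mxtraceD !mulmxA.
  rewrite -(mulmxA _ _ U) hl mulmx0 mul0mx mxtrace0 add0r.
  by rewrite mxtrace_mulC !mulmxA hr !mul0mx mxtrace0.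
have TB Y Y' : tangent_set U V Y -> tangent_set U V Y' -> tangent_set U V (Y - Y').
  case=> A [B ->] [A' [B' ->]]; exists (A - A'), (B - B').
  by rewrite linearB /= mulmxBr mulmxBl opprD addrACA.
apply: xget_unique => // Y [TY oY].
apply/eqP; rewrite -subr_eq0; apply/eqP/inner_eq0.
have d := TB _ _ TY TP.
have := oP _ d; have := oY _ d.
rewrite /inner => h1 h2.
have {1}-> : Y - P = (Z - P) - (Z - Y) by rewrite (opprB Z Y) [RHS]addrC subrKA.
by rewrite (linearB trmx) mulmxBl linearB /= h1 h2 subrr.
Qed.

(* Main.v *)
Require Import Defs.
From HB Require Import structures.
From mathcomp Require Import all_boot all_order all_algebra.
From mathcomp Require Import boolp classical_sets reals.
From mathcomp Require Import ring lra zify.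
From mathcomp Require Import sesquilinear spectral complex.
Set Implicit Arguments.
Unset Strict Implicit.
Unset Printing Implicit Defensive.
Import Order.TTheory GRing.Theory Num.Theory.
Local Open Scope ring_scope.
Local Open Scope classical_set_scope.

(* Let A = P_T(Z), Y a nearest point of C to A, and D = A - Y. Comparing Y with
   other matrices of rank at most r shows that D is orthogonal to the row and
   column spaces of Y and that |D v| |w| <= |Y w| |v| for w in the row space of Y,
   hence |D|_sp <= |A - X|_sp <= 2 |Z - X|_sp for every X in C; as
   Z - A = (1 - UU^T)(Z - X)(1 - VV^T), this gives (ii).
   For (i), if X G X = X and E is orthogonal to the row and column spaces of Y then
   <X, E> = <(X - Y) G (X - Y), E> <= |E|_sp |G|_sp |X - Y|_F^2, and every matrix of C
   in the ball has such a G with |G|_sp <= 4 / (3 sigma_r(Xhat)).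
   For (iii), |D|_sp <= (7/12) sigma_r(Xhat) while Y is bounded below by
   (3/4) sigma_r(Xhat) on its row space, so Y is still a nearest point to
   Y + (9/7) D; the slack makes P_C Lipschitz at A. *)

(** * Trace inner product, Frobenius norm and operator bounds *)

Lemma innerC (R : realType) n m (A B : 'M[R]_(n, m)) : inner A B = inner B A.
Proof. by rewrite /inner -mxtrace_tr trmx_mul trmxK. Qed.

Lemma innerDl (R : realType) n m (A B C : 'M[R]_(n, m)) :
  inner (A + B) C = inner A C + inner B C.
Proof. by rewrite /inner linearD /= mulmxDl mxtraceD. Qed.

Lemma innerZl (R : realType) n m (a : R) (A B : 'M[R]_(n, m)) :
  inner (a *: A) B = a * inner A B.
Proof. by rewrite /inner linearZ /= -scalemxAl mxtraceZ. Qed.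

Lemma innerDr (R : realType) n m (A B C : 'M[R]_(n, m)) :
  inner C (A + B) = inner C A + inner C B.
Proof. by rewrite innerC innerDl !(innerC C). Qed.

Lemma innerZr (R : realType) n m (a : R) (A B : 'M[R]_(n, m)) :
  inner A (a *: B) = a * inner A B.
Proof. by rewrite innerC innerZl innerC. Qed.

Lemma innerNl (R : realType) n m (A B : 'M[R]_(n, m)) : inner (- A) B = - inner A B.
Proof. by rewrite -scaleN1r innerZl mulN1r. Qed.

Lemma innerNr (R : realType) n m (A B : 'M[R]_(n, m)) : inner A (- B) = - inner A B.
Proof. by rewrite innerC innerNl innerC. Qed.

Lemma inner0r (R : realType) n m (A : 'M[R]_(n, m)) : inner A 0 = 0.
Proof. by rewrite /inner mulmx0 mxtrace0. Qed.

Definition innerE := (innerDl, innerDr, innerNl, innerNr, innerZl, innerZr).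

Lemma inner_sqrD (R : realType) n m (A B : 'M[R]_(n, m)) :
  inner (A + B) (A + B) = inner A A + 2 * inner A B + inner B B.
Proof. by rewrite !innerE (innerC B A); ring. Qed.

Lemma inner_pythagoras (R : realType) n m (A B : 'M[R]_(n, m)) :
  inner A B = 0 -> inner (A + B) (A + B) = inner A A + inner B B.
Proof. by move=> AB; rewrite inner_sqrD AB mulr0 addr0. Qed.

Lemma inner_mull (R : realType) n m p (A : 'M[R]_(n, m)) (B : 'M[R]_(m, p))
    (C : 'M[R]_(n, p)) :
  inner (A *m B) C = inner B (A^T *m C).
Proof. by rewrite /inner trmx_mul mulmxA. Qed.

Lemma inner_mulr (R : realType) n m p (A : 'M[R]_(n, m)) (B : 'M[R]_(m, p))
    (C : 'M[R]_(n, p)) :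
  inner (A *m B) C = inner A (C *m B^T).
Proof. by rewrite /inner trmx_mul -mulmxA mxtrace_mulC mulmxA. Qed.

Lemma inner_tr (R : realType) n m (A B : 'M[R]_(n, m)) :
  inner A^T B^T = inner A B.
Proof. by rewrite /inner trmxK mxtrace_mulC -mxtrace_tr trmx_mul trmxK. Qed.

Lemma inner_ge0 (R : realType) n m (A : 'M[R]_(n, m)) : 0 <= inner A A.
Proof.
rewrite /inner /mxtrace sumr_ge0 // => i _; rewrite mxE sumr_ge0 // => j _.
by rewrite mxE -expr2 sqr_ge0.
Qed.

Lemma inner_gt0 (R : realType) n m (A : 'M[R]_(n, m)) : (0 < inner A A) = (A != 0).
Proof.
rewrite lt_def inner_ge0 andbT; congr (~~ _); apply/eqP/eqP => [|->].
  exact: inner_eq0.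
exact: inner0r.
Qed.

Lemma inner_col (R : realType) n m (A B : 'M[R]_(n, m)) :
  inner A B = \sum_j inner (col j A) (col j B).
Proof.
apply: eq_bigr => j _; rewrite /inner /mxtrace big_ord1 !mxE.
by apply: eq_bigr => i _; rewrite !mxE.
Qed.

Lemma frob_norm_ge0 (R : realType) n m (A : 'M[R]_(n, m)) : 0 <= frob_norm A.
Proof. exact: sqrtr_ge0. Qed.

Lemma sqr_frob_norm (R : realType) n m (A : 'M[R]_(n, m)) :
  frob_norm A ^+ 2 = inner A A.
Proof. by rewrite sqr_sqrtr // inner_ge0. Qed.

Lemma frob_norm_gt0 (R : realType) n m (A : 'M[R]_(n, m)) :
  (0 < frob_norm A) = (A != 0).
Proof. by rewrite sqrtr_gt0 inner_gt0. Qed.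

Lemma frob_norm0 (R : realType) n m : frob_norm (0 : 'M[R]_(n, m)) = 0.
Proof. by rewrite /frob_norm inner0r sqrtr0. Qed.

Lemma frob_normN (R : realType) n m (A : 'M[R]_(n, m)) : frob_norm (- A) = frob_norm A.
Proof. by rewrite /frob_norm innerNl innerNr opprK. Qed.

Lemma frob_normB (R : realType) n m (A B : 'M[R]_(n, m)) :
  frob_norm (A - B) = frob_norm (B - A).
Proof. by rewrite -frob_normN opprB. Qed.

Lemma frob_norm_tr (R : realType) n m (A : 'M[R]_(n, m)) : frob_norm A^T = frob_norm A.
Proof. by rewrite /frob_norm inner_tr. Qed.

Lemma frob_norm_le (R : realType) n m p q (A : 'M[R]_(n, m)) (B : 'M[R]_(p, q)) :
  (frob_norm A <= frob_norm B) = (inner A A <= inner B B).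
Proof. by rewrite ler_sqrt // inner_ge0. Qed.

Lemma frob_norm_leP (R : realType) n m (A : 'M[R]_(n, m)) (s : R) :
  0 <= s -> (frob_norm A <= s) = (inner A A <= s ^+ 2).
Proof.
by move=> s0; rewrite -sqr_frob_norm ler_sqr // nnegrE // frob_norm_ge0.
Qed.

Lemma inner_cauchy (R : realType) n m (A B : 'M[R]_(n, m)) :
  inner A B <= frob_norm A * frob_norm B.
Proof.
have [->|A0] := eqVneq A 0; first by rewrite innerC inner0r frob_norm0 mul0r.
have [le0|gt0] := lerP (inner A B) 0.
  by apply: le_trans le0 _; rewrite mulr_ge0 // frob_norm_ge0.
rewrite -ler_sqr ?nnegrE ?mulr_ge0 ?frob_norm_ge0 ?(ltW gt0) //.
rewrite exprMn !sqr_frob_norm.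
have a0 : 0 < inner A A by rewrite inner_gt0.
(* The squared norm of this combination is [inner A A] times the Cauchy-Schwarz defect. *)
have := inner_ge0 (inner A A *: B - inner A B *: A).
rewrite !innerE (innerC B A) => h.
rewrite -(ler_pM2l a0) -subr_ge0; apply: le_trans h _.
by rewrite le_eqVlt; apply/orP; left; apply/eqP; ring.
Qed.

Lemma frob_normD (R : realType) n m (A B : 'M[R]_(n, m)) :
  frob_norm (A + B) <= frob_norm A + frob_norm B.
Proof.
rewrite frob_norm_leP ?addr_ge0 ?frob_norm_ge0 //.
rewrite !innerE (innerC B A) sqrrD !sqr_frob_norm.
have := inner_cauchy A B; lra.
Qed.

(** Entries of [A *m B] are inner products of rows of [A] with columns of [B]; Cauchy-Schwarz
    applies to each. *)
Lemma frob_normM (R : realType) n m p (A : 'M[R]_(n, m)) (B : 'M[R]_(m, p)) :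
  frob_norm (A *m B) <= frob_norm A * frob_norm B.
Proof.
rewrite frob_norm_leP ?mulr_ge0 ?frob_norm_ge0 //.
rewrite exprMn !sqr_frob_norm -[inner A A]inner_tr inner_col.
rewrite [inner A^T _]inner_col mulr_suml.
have -> : \sum_j inner (col j (A *m B)) (col j (A *m B)) =
          \sum_i \sum_j inner (col i A^T) (col j B) ^+ 2.
  rewrite [RHS]exchange_big /=; apply: eq_bigr => j _.
  rewrite {1}/inner /mxtrace big_ord1 mxE; apply: eq_bigr => i _.
  rewrite /inner /mxtrace big_ord1 !mxE -expr2; congr (_ ^+ 2).
  by apply: eq_bigr => k _; rewrite !mxE.
apply: ler_sum => i _; rewrite [inner B B]inner_col mulr_sumr.
apply: ler_sum => j _; rewrite -!sqr_frob_norm -exprMn.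
rewrite -[leLHS]real_normK ?num_real // ler_sqr ?nnegrE ?mulr_ge0 ?frob_norm_ge0 //.
rewrite ler_norml inner_cauchy andbT lerNl -innerNl.
by rewrite -(frob_normN (col i A^T)) inner_cauchy.
Qed.

(** Stands in for a bound on [sp_norm], so that sums, products and transposes are handled without
    eigenvalues; [op_le_sp_norm] and [sp_norm_le] translate. *)
Definition op_le (R : realType) n m (A : 'M[R]_(n, m)) (s : R) : Prop :=
  forall x : 'cV[R]_m, frob_norm (A *m x) <= s * frob_norm x.

Lemma op_le_mx (R : realType) n m p (A : 'M[R]_(n, m)) (B : 'M[R]_(m, p)) (s : R) :
  op_le A s -> 0 <= s -> frob_norm (A *m B) <= s * frob_norm B.
Proof.
move=> As s0; rewrite frob_norm_leP ?mulr_ge0 ?frob_norm_ge0 //.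
rewrite exprMn sqr_frob_norm !inner_col mulr_sumr; apply: ler_sum => j _.
rewrite -sqr_frob_norm -(sqr_frob_norm (col j B)) -exprMn.
by rewrite ler_sqr ?nnegrE ?mulr_ge0 ?frob_norm_ge0 // !colE -mulmxA.
Qed.

Lemma op_le_frob (R : realType) n m (A : 'M[R]_(n, m)) : op_le A (frob_norm A).
Proof. by move=> x; apply: frob_normM. Qed.

Lemma op_leW (R : realType) n m (A : 'M[R]_(n, m)) (s t : R) :
  s <= t -> op_le A s -> op_le A t.
Proof.
by move=> st As x; apply: le_trans (As x) _; rewrite ler_wpM2r ?frob_norm_ge0.
Qed.

Lemma op_leN (R : realType) n m (A : 'M[R]_(n, m)) (s : R) :
  op_le A s -> op_le (- A) s.
Proof. by move=> As x; rewrite mulNmx frob_normN. Qed.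

Lemma op_leD (R : realType) n m (A B : 'M[R]_(n, m)) (s t : R) :
  op_le A s -> op_le B t -> op_le (A + B) (s + t).
Proof.
move=> As Bt x; rewrite mulmxDl mulrDl; apply: le_trans (frob_normD _ _) _.
exact: lerD.
Qed.

Lemma op_leM (R : realType) n m p (A : 'M[R]_(n, m)) (B : 'M[R]_(m, p)) (s t : R) :
  0 <= s -> op_le A s -> op_le B t -> op_le (A *m B) (s * t).
Proof.
move=> s0 As Bt x; rewrite -mulmxA; apply: le_trans (As _) _.
by rewrite -mulrA ler_wpM2l.
Qed.

(** By Cauchy-Schwarz [|A^T y|^2 = <y, A A^T y> <= |y| |A A^T y|], so [A] only has to be controlled
    on the range of [A^T]. *)
Lemma op_le_tr_range (R : realType) n m (A : 'M[R]_(n, m)) (s : R) : 0 <= s ->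
  (forall y : 'cV_n, frob_norm (A *m (A^T *m y)) <= s * frob_norm (A^T *m y)) ->
  op_le A^T s.
Proof.
move=> s0 As y; have [->|z] := eqVneq (A^T *m y) 0.
  by rewrite frob_norm0 mulr_ge0 ?frob_norm_ge0.
rewrite -(ler_pM2l (_ : 0 < frob_norm (A^T *m y))) ?frob_norm_gt0 //.
rewrite -expr2 sqr_frob_norm inner_mull trmxK.
apply: le_trans (inner_cauchy _ _) _; rewrite mulrC mulrA (mulrC _ s).
by rewrite ler_wpM2r ?frob_norm_ge0.
Qed.

Lemma op_le_tr (R : realType) n m (A : 'M[R]_(n, m)) (s : R) : 0 <= s ->
  op_le A s -> op_le A^T s.
Proof. by move=> s0 As; apply: op_le_tr_range. Qed.

Lemma op_le_proj (R : realType) n (P : 'M[R]_n) :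
  P^T = P -> P *m P = P -> op_le P 1.
Proof.
move=> PT PP; rewrite -PT; apply: op_le_tr_range => // y.
by rewrite mul1r PT mulmxA PP.
Qed.

Lemma proj_compl (R : realType) n (P : 'M[R]_n) :
  P^T = P -> P *m P = P ->
  (1%:M - P)^T = 1%:M - P /\ (1%:M - P) *m (1%:M - P) = 1%:M - P.
Proof.
move=> PT PP; split; first by rewrite linearB /= trmx1 PT.
by rewrite mulmxBr mulmxBl mul1mx mulmx1 mulmxBl mul1mx PP subrr subr0.
Qed.

Lemma op_le_subproj (R : realType) n (P : 'M[R]_n) :
  P^T = P -> P *m P = P -> op_le (1%:M - P) 1.
Proof. by move=> PT PP; have [? ?] := proj_compl PT PP; apply: op_le_proj. Qed.

(** * Nearest points of bounded rank *)

Lemma inner_first_order (R : realType) n m (D E : 'M[R]_(n, m)) :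
  (forall t : R, inner D D <= inner (D - t *: E) (D - t *: E)) -> inner D E = 0.
Proof.
move=> h; have [->|E0] := eqVneq E 0; first exact: inner0r.
have e0 : 0 < inner E E by rewrite inner_gt0.
(* This [t] minimises the quadratic on the right. *)
have := h (inner D E / inner E E); rewrite !innerE (innerC E D).
set c := inner D E; set e := inner E E => h1.
have h2 : c / e * (c / e * e) = c ^+ 2 / e by field; rewrite gt_eqF.
have h3 : c / e * c = c ^+ 2 / e by ring.
have h4 : c ^+ 2 / e <= 0 by rewrite mulrN h2 h3 in h1; lra.
apply/eqP; rewrite -sqrf_eq0; apply/eqP/le_anti; rewrite sqr_ge0 andbT.
by rewrite -(ler_pM2r (_ : 0 < e^-1)) ?invr_gt0 // mul0r.
Qed.

Lemma rank1_le (R : realType) k l (u : 'cV[R]_k) (w : 'rV[R]_l) : (\rank (u *m w) <= 1)%N.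
Proof. by apply: leq_trans (mxrankM_maxl _ _) (rank_leq_col _). Qed.

Lemma mul_cV_tr (R : realType) n (v : 'cV[R]_n) : v^T *m v = (inner v v)%:M.
Proof. by rewrite [LHS]mx11_scalar /inner /mxtrace big_ord1. Qed.

(** The subtracted matrix is [M] composed with the orthogonal projector on the line of [v], so
    Pythagoras applies. *)
Lemma inner_sub_rank1 (R : realType) n m (M : 'M[R]_(n, m)) (v : 'cV[R]_m) :
  v != 0 ->
  inner (M - (inner v v)^-1 *: (M *m v *m v^T)) (M - (inner v v)^-1 *: (M *m v *m v^T))
  = inner M M - inner (M *m v) (M *m v) / inner v v.
Proof.
move=> v0; have vv0 : inner v v != 0 by rewrite gt_eqF // inner_gt0.
have e1 : inner M (M *m v *m v^T) = inner (M *m v) (M *m v).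
  by rewrite innerC inner_mulr trmxK.
have e2 : inner (M *m v *m v^T) (M *m v *m v^T) =
    inner v v * inner (M *m v) (M *m v).
  rewrite inner_mulr trmxK -(mulmxA (M *m v)) mul_cV_tr.
  by rewrite mul_mx_scalar innerZr.
rewrite !innerE [inner (_ *m _ *m _) M]innerC e1 e2.
by field.
Qed.

Section NearestLowRank.

Context {R : realType} {n m : nat} {r : nat} {A Y : 'M[R]_(n, m)}.
Hypothesis nY : is_nearest_point (@rank_le R n m r) A Y.

Let D := A - Y.

Lemma nearest_inner_le (X : 'M[R]_(n, m)) :
  (\rank X <= r)%N -> inner D D <= inner (A - X) (A - X).
Proof.
move=> rX; rewrite -frob_norm_le (frob_normB A Y) (frob_normB A X).
exact: nY.2.
Qed.

(** The competitors [Y (1 + t K)] have rank at most that of [Y]; for [K = Y^T D] the first-order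
    condition reads [|Y^T D|^2 = 0]. *)
Lemma nearest_trmul0 : Y^T *m D = 0.
Proof.
apply: inner_eq0; rewrite inner_mull trmxK; apply: inner_first_order => t.
have -> : D - t *: (Y *m (Y^T *m D)) = A - Y *m (1%:M + t *: (Y^T *m D)).
  by rewrite mulmxDr mulmx1 -scalemxAr opprD addrA.
by apply: nearest_inner_le; apply: leq_trans (mxrankM_maxl _ _) nY.1.
Qed.

Lemma nearest_multr0 : D *m Y^T = 0.
Proof.
apply: inner_eq0; rewrite inner_mulr trmxK; apply: inner_first_order => t.
have -> : D - t *: (D *m Y^T *m Y) = A - (1%:M + t *: (D *m Y^T)) *m Y.
  by rewrite mulmxDl mul1mx -scalemxAl opprD addrA.
by apply: nearest_inner_le; apply: leq_trans (mxrankM_maxr _ _) nY.1.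
Qed.

(** With rank to spare, the part of [D] along any [v] could be added to [Y], lowering the distance
    by [|D v|^2 / |v|^2]. *)
Lemma nearest_rank_lt : (\rank Y < r)%N -> A = Y.
Proof.
move=> rY; suff D0 (v : 'cV_m) : D *m v = 0.
  apply/eqP; rewrite -subr_eq0; apply/eqP/matrixP => i j.
  by have /matrixP/(_ i ord0) := D0 (delta_mx j ord0); rewrite -colE !mxE.
have [->|v0] := eqVneq v 0; first exact: mulmx0.
set X := Y + (inner v v)^-1 *: (D *m v *m v^T).
have rX : (\rank X <= r)%N.
  apply: leq_trans (mxrank_add _ _) _; apply: leq_trans _ rY.
  rewrite -[(\rank Y).+1]addn1 leq_add2l scalemxAl; exact: rank1_le.
have := nearest_inner_le rX; rewrite opprD addrA inner_sub_rank1 //.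
rewrite -/D => h; apply: inner_eq0; apply/le_anti; rewrite inner_ge0 andbT.
rewrite -(ler_pM2r (_ : 0 < (inner v v)^-1)) ?invr_gt0 ?inner_gt0 // mul0r; lra.
Qed.

(* Otherwise exchanging the component of [Y] along [v0] for the component of
   [D] along [v] would lower the distance to [A]. *)
Lemma nearest_exchange (v v0 : 'cV[R]_m) : (v0^T <= Y)%MS ->
  inner (D *m v) (D *m v) * inner v0 v0 <= inner (Y *m v0) (Y *m v0) * inner v v.
Proof.
move=> sv0; have [->|nv] := eqVneq v 0.
  by rewrite mulmx0 !inner0r mul0r mulr0.
have [->|nv0] := eqVneq v0 0; first by rewrite mulmx0 !inner0r mul0r mulr0.
have pv : 0 < inner v v by rewrite inner_gt0.
have pv0 : 0 < inner v0 v0 by rewrite inner_gt0.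
set F := (inner v0 v0)^-1 *: (Y *m v0 *m v0^T).
set G := (inner v v)^-1 *: (D *m v *m v^T).
(* [Y - F] kills [v0]. Were its row space all of that of [Y], it would contain [v0], making [v0]
   orthogonal to itself. *)
have rF : (\rank (Y - F)%R < \rank Y)%N.
  have sub : (Y - F <= Y)%MS.
    by rewrite addmx_sub // eqmx_opp scalemx_sub // mulmx_sub.
  rewrite ltn_neqAle mxrankS // andbT; apply/negP => /eqP e.
  have := mxrank_leqif_sup sub; rewrite e => -[_]; rewrite eqxx => /esym sY.
  have /submxP[u eu] : (v0^T <= Y - F)%MS by apply: submx_trans sv0 sY.
  have : inner v0 v0 = 0.
    have : v0^T *m v0 = 0.
      rewrite {1}eu -mulmxA mulmxBl /F -scalemxAl -(mulmxA _ v0^T) mul_cV_tr.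
      by rewrite mul_mx_scalar scalerA mulVf ?gt_eqF // scale1r subrr mulmx0.
    by rewrite /inner => ->; rewrite mxtrace0.
  by move/eqP; rewrite gt_eqF.
have rX : (\rank (Y - F + G)%R <= r)%N.
  apply: leq_trans (mxrank_add _ _) _; apply: leq_trans _ nY.1.
  apply: leq_trans _ rF; rewrite -[(\rank (Y - F)%R).+1]addn1 leq_add2l /G.
  by rewrite scalemxAl rank1_le.
have := nearest_inner_le rX.
have -> : A - (Y - F + G) = (D - G) + F by rewrite /D !opprD opprK !addrA;
  apply/matrixP => i j; rewrite !mxE; ring.
have YD := nearest_trmul0.
(* The columns of [F] lie in the column space of [Y], those of [D - G] in that of [D], and these are
   orthogonal. *)
rewrite [leRHS]inner_pythagoras; last first.
  rewrite [LHS]innerC /F innerZl inner_mull trmx_mul -mulmxA mulmxBr /G -scalemxAr.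
  by rewrite !mulmxA YD !mul0mx scaler0 subrr mulmx0 inner0r mulr0.
have -> : inner F F = inner (Y *m v0) (Y *m v0) / inner v0 v0.
  rewrite /F innerZl innerZr inner_mulr trmxK -(mulmxA (Y *m v0)) mul_cV_tr.
  by rewrite mul_mx_scalar innerZr; field; rewrite gt_eqF.
rewrite inner_sub_rank1 // -/D => h.
have {}h : inner (D *m v) (D *m v) / inner v v <=
    inner (Y *m v0) (Y *m v0) / inner v0 v0 by lra.
by rewrite ler_pdivrMr // mulrAC ler_pdivlMr in h.
Qed.

End NearestLowRank.

Lemma inner_mul0l (R : realType) n m p (A : 'M[R]_(n, m)) (B : 'M[R]_(m, p))
    (C : 'M[R]_(n, p)) : A^T *m C = 0 -> inner (A *m B) C = 0.
Proof. by move=> h; rewrite inner_mull h inner0r. Qed.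

Lemma inner_mul0r (R : realType) n m p (A : 'M[R]_(n, m)) (B : 'M[R]_(m, p))
    (C : 'M[R]_(n, p)) : C *m B^T = 0 -> inner (A *m B) C = 0.
Proof. by move=> h; rewrite inner_mulr h inner0r. Qed.

(* [X] has a kernel of codimension at most [r], hence vanishes somewhere on the
   sum of the row space of [Y] (of dimension [r]) and a line orthogonal to it. *)
Lemma nearest_op_le (R : realType) n m r (A Y X : 'M[R]_(n, m)) (s : R) :
  is_nearest_point (@rank_le R n m r) A Y -> (\rank X <= r)%N -> 0 <= s ->
  op_le (A - X) s -> op_le (A - Y) s.
Proof.
move=> nY rX s0 As; set D := A - Y.
have [rY|rY] := ltnP (\rank Y) r.
  rewrite /D -(nearest_rank_lt nY rY) subrr => x.
  by rewrite mul0mx frob_norm0 mulr_ge0 ?frob_norm_ge0.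
have YD : Y^T *m D = 0 := nearest_trmul0 nY.
have DY : D *m Y^T = 0 := nearest_multr0 nY.
have AE : A = Y + D by rewrite /D addrC subrK.
have ex (v v0 : 'cV_m) : (v0^T <= Y)%MS ->
    inner (D *m v) (D *m v) * inner v0 v0 <= inner (Y *m v0) (Y *m v0) * inner v v.
  exact: (nearest_exchange nY).
move: D YD DY AE ex => D YD DY AE exchange.
(* Transposing twice leaves only vectors [v] in the row space of [D] to test; these are orthogonal
   to the rows of [Y]. *)
rewrite -[D]trmxK; apply: op_le_tr => //;
apply: op_le_tr_range => // y; set v := D^T *m y.
have [->|v0] := eqVneq v 0; first by rewrite mulmx0 !frob_norm0 mulr0.
have Yv : Y *m v = 0.
  by rewrite /v mulmxA -[Y *m D^T]trmxK trmx_mul trmxK DY trmx0 mul0mx.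
have nvY : ~~ (v^T <= Y)%MS.
  apply/negP => /submxP[u eu]; move: (v0); rewrite -inner_gt0.
  by rewrite /inner eu -mulmxA Yv mulmx0 mxtrace0 ltxx.
have rYv : (r < \rank (Y + v^T)%MS)%N.
  apply: leq_ltn_trans rY _; rewrite ltn_neqAle mxrankS ?addsmxSl // andbT.
  apply/negP => /eqP e; have := mxrank_leqif_sup (addsmxSl Y v^T).
  rewrite e => -[_]; rewrite eqxx => /esym h; case/negP: nvY.
  exact: submx_trans (addsmxSr Y v^T) h.
set W := (Y + v^T)%MS in rYv.
(* The dimensions add up to more than [m]: above [r] for [W], at least [m - r] for the kernel. *)
have : (W :&: kermx X^T)%MS != 0.
  rewrite -mxrank_eq0 -lt0n.
  have := mxrank_sum_cap W (kermx X^T).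
  rewrite mxrank_ker mxrank_tr => e.
  have := rank_leq_col (W + kermx X^T)%MS; have := rank_leq_col X; lia.
case/rowV0Pn => w; rewrite sub_capmx => /andP[/sub_addsmxP[[a c] /= ew] /sub_kermxP wX] w0.
set v0' := Y^T *m a^T; set k := c ord0 ord0.
have ew' : w^T = v0' + k *: v.
  rewrite ew linearD /= (trmx_mul a) (trmx_mul c) trmxK (mx11_scalar c).
  by rewrite tr_scalar_mx mul_mx_scalar.
have Xw : X *m w^T = 0 by rewrite -[X *m _]trmxK trmx_mul trmxK wX trmx0.
have ex : inner (D *m v) (D *m v) * inner v0' v0' <=
    inner (Y *m v0') (Y *m v0') * inner v v.
  by apply: exchange; rewrite /v0' trmx_mul !trmxK submxMl.
have := As w^T; rewrite mulmxBl Xw subr0 frob_norm_leP ?mulr_ge0 ?frob_norm_ge0 //.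
have Dv0' : D *m v0' = 0 by rewrite /v0' mulmxA DY mul0mx.
have -> : A *m w^T = Y *m v0' + k *: (D *m v).
  by rewrite AE ew' mulmxDr !mulmxDl -!scalemxAr Yv Dv0' scaler0 !add0r addr0.
have w0' : 0 < inner w^T w^T by rewrite inner_tr inner_gt0.
rewrite exprMn sqr_frob_norm ew' in w0' *.
have o1 : inner (Y *m v0') (k *: (D *m v)) = 0.
  by rewrite innerZr inner_mul0l ?mulr0 // mulmxA YD mul0mx.
have o2 : inner v0' (k *: v) = 0.
  by rewrite innerZr /v0' inner_mul0l ?mulr0 // trmxK.
rewrite !inner_pythagoras // !innerE in w0' * => h.
(* With [N = |v0'|^2 + k^2 |v|^2], the exchange inequality gives [|D v|^2 N <= |v|^2 (|Y v0'|^2 +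
   k^2 |D v|^2)], and [h] bounds the last factor by [s^2 N]. *)
rewrite frob_norm_leP ?mulr_ge0 ?frob_norm_ge0 // exprMn sqr_frob_norm.
rewrite -(ler_pM2r w0').
set a1 := inner (D *m v) _ in h ex *; set b1 := inner v v in h ex *.
have b0 : 0 <= b1 := inner_ge0 v.
have := ler_wpM2r b0 h.
set V0 := inner v0' v0' in h ex *; set Y0 := inner (Y *m _) _ in h ex *.
by move: ex; clear; move=> h1 h2; nra.
Qed.

(* [X = X G X] gives [inner X D = inner ((X - Y) G (X - Y)) D], which is quadratic in
   [X - Y]. *)
Lemma inner_normal_le (R : realType) n m (X Y D : 'M[R]_(n, m)) (G : 'M[R]_(m, n))
    (d g : R) :
  X *m G *m X = X -> Y^T *m D = 0 -> D *m Y^T = 0 -> 0 <= d -> 0 <= g ->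
  op_le D d -> op_le G g -> inner X D <= d * g * frob_norm (X - Y) ^+ 2.
Proof.
move=> XGX YD DY d0 g0 Dd Gg.
have -> : inner X D = inner ((X - Y) *m (G *m (X - Y))) D.
  rewrite mulmxBr mulmxBl mulmxBr mulmxA XGX mulmxBr !innerE.
  rewrite !mulmxA (inner_mul0r (X *m G)) // -!mulmxA.
  by rewrite !(inner_mul0l (A := Y)) // !subr0.
rewrite inner_mull; apply: le_trans (inner_cauchy _ _) _.
rewrite -[frob_norm (_^T *m D)]frob_norm_tr trmx_mul trmxK.
set K := X - Y; rewrite [leRHS](_ : _ = g * frob_norm K * (d * frob_norm K)); last by ring.
apply: ler_pM; rewrite ?frob_norm_ge0 ?op_le_mx //.
exact: op_le_tr.
Qed.


(** * Gram matrices, pseudo-inverses and row-space projectors *)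

Lemma row_free_gram_unit (R : realType) n r (M : 'M[R]_(n, r)) :
  row_free M^T -> M^T *m M \in unitmx.
Proof.
move=> fM; rewrite -row_free_unit -kermx_eq0; apply/eqP/row_matrixP => i.
rewrite row0; set u := row i _.
have : u *m (M^T *m M) = 0 by apply/sub_kermxP; rewrite /u row_sub.
move=> h; have : inner (u *m M^T)^T (u *m M^T)^T = 0.
  by rewrite /inner trmxK trmx_mul trmxK mulmxA -(mulmxA u) h mul0mx mxtrace0.
move/inner_eq0 => /(congr1 trmx); rewrite trmxK trmx0 => e.
by apply: (row_free_inj fM); rewrite e mul0mx.
Qed.

(** [M = Y B^T] is injective, so it spans the whole column space of [Y]. With [H] its least-squares
    left inverse, [G = B^T H] works: [M H] is an orthogonal projector, hence
    [s |G y| <= |M H y| <= |y|]. The rows of [B] may span the row space of another matrix than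
    [Y]. *)
Lemma pseudo_inverse_ex (R : realType) n m r (Y : 'M[R]_(n, m)) (B : 'M[R]_(r, m)) (s : R) :
  0 < s -> (\rank Y <= r)%N -> row_free B ->
  (forall x : 'cV_m, (x^T <= B)%MS -> s * frob_norm x <= frob_norm (Y *m x)) ->
  \rank Y = r /\ exists2 G, Y *m G *m Y = Y & op_le G s^-1.
Proof.
move=> s0 rY fB lB; set M := Y *m B^T.
have fM : row_free M^T.
  rewrite -kermx_eq0; apply/eqP/row_matrixP => i; rewrite row0; set u := row i _.
  have h : u *m M^T = 0 by apply/sub_kermxP; rewrite /u row_sub.
  have := lB (u *m B)^T; rewrite trmxK submxMl trmx_mul mulmxA -/M => /(_ isT).
  rewrite -[M *m u^T]trmxK trmx_mul trmxK h trmx0 frob_norm0 pmulr_rle0 //.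
  move=> h'; apply: (row_free_inj fB); rewrite mul0mx.
  apply/eqP; apply: contraTT h'; rewrite -ltNge frob_norm_gt0 -trmx_mul.
  by apply: contra => /eqP e; rewrite -[_ *m _]trmxK e trmx0.
have lM (y : 'cV_r) : frob_norm (B^T *m y) * s <= frob_norm (M *m y).
  by rewrite mulrC -mulmxA; apply: lB; rewrite trmx_mul trmxK submxMl.
have sMY : (M^T <= Y^T)%MS by rewrite /M trmx_mul trmxK submxMl.
have eY : \rank Y = r.
  by apply/eqP; rewrite eqn_leq rY -(mxrank_tr Y) -[X in (X <= _)%N](eqP fM) mxrankS.
have gu := row_free_gram_unit fM.
set H := invmx (M^T *m M) *m M^T.
have HM : H *m M = 1%:M by rewrite /H -mulmxA mulVmx.
have PM : (M *m H)^T = M *m H.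
  by rewrite /H (trmx_mul M) (trmx_mul _ M^T) trmxK trmx_inv (trmx_mul _ M) trmxK (mulmxA M).
split=> //; exists (B^T *m H).
  have /submxP[K eK] : (Y^T <= M^T)%MS.
    have := mxrank_leqif_sup sMY; rewrite (eqP fM) mxrank_tr => -[_].
    by rewrite eY eqxx => /esym.
  have {}eK : Y = M *m K^T by rewrite -[Y]trmxK eK trmx_mul trmxK.
  rewrite mulmxA -/M; move: M fM lM sMY gu H HM PM eK => M fM lM sMY gu H HM PM eK.
  by rewrite eK mulmxA -(mulmxA M H M) HM mulmx1.
move=> y; rewrite -mulmxA ler_pdivlMl //.
rewrite mulrC; apply: le_trans (lM _) _; rewrite mulmxA -[leRHS]mul1r.
apply: op_le_proj => //; move: M H HM {PM sMY gu lM fM} => M H HM.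
by rewrite mulmxA -(mulmxA M H M) HM mulmx1.
Qed.

(** [Q = B^T (B B^T)^-1 B] for a row basis [B]. The trace clause turns comparisons of ranks into
    inequalities between reals. *)
Lemma row_projector_ex (R : realType) n m (X : 'M[R]_(n, m)) :
  exists Q : 'M[R]_m, [/\ Q^T = Q, Q *m Q = Q, X *m Q = X, (Q <= X)%MS
    & \tr Q = (\rank X)%:R].
Proof.
set B := row_base X.
have gu : B *m B^T \in unitmx.
  by rewrite -{1}[B]trmxK row_free_gram_unit // trmxK row_base_free.
have [K eK] : exists K, X = K *m B by apply/submxP; rewrite /B eq_row_base.
have sB : (B <= X)%MS by rewrite /B eq_row_base.
move: B gu eK sB => B gu eK sB.
exists (B^T *m invmx (B *m B^T) *m B).
have BQ : B *m (B^T *m invmx (B *m B^T) *m B) = B.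
  by rewrite !mulmxA mulmxV // mul1mx.
split.
- by rewrite !trmx_mul trmx_inv trmx_mul trmxK mulmxA.
- by rewrite -[LHS](mulmxA _ B) BQ.
- by rewrite {1}eK -(mulmxA K B) BQ -eK.
- by rewrite mulmx_sub.
- by rewrite mxtrace_mulC mulmxA mulmxV // mxtrace1.
Qed.

(** * Lower bounds on row spaces and stability of nearest points *)

Lemma inner_proj_mul (R : realType) n (P Q : 'M[R]_n) :
  P^T = P -> P *m P = P -> Q^T = Q -> Q *m Q = Q ->
  inner (P *m Q) (P *m Q) = \tr (P *m Q).
Proof.
move=> PT PP QT QQ; rewrite inner_mull PT mulmxA PP /inner QT.
by rewrite mxtrace_mulC -mulmxA QQ.
Qed.

(** Equivalently, every nonzero singular value of [Y] is at least [a]. *)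
Definition row_lower (R : realType) n m (Y : 'M[R]_(n, m)) (a : R) : Prop :=
  forall x : 'cV[R]_m, (x^T <= Y)%MS -> a * frob_norm x <= frob_norm (Y *m x).

Lemma row_lower_mx (R : realType) n m p (Y : 'M[R]_(n, m)) (a : R) (B : 'M[R]_(m, p)) :
  0 <= a -> row_lower Y a -> (B^T <= Y)%MS -> a * frob_norm B <= frob_norm (Y *m B).
Proof.
move=> a0 lY sB.
rewrite -ler_sqr ?nnegrE ?mulr_ge0 ?frob_norm_ge0 // exprMn !sqr_frob_norm.
rewrite !inner_col mulr_sumr; apply: ler_sum => j _.
rewrite -sqr_frob_norm -exprMn -[leRHS]sqr_frob_norm.
rewrite ler_sqr ?nnegrE ?mulr_ge0 ?frob_norm_ge0 // [col j (Y *m B)]colE -mulmxA -colE.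
by apply: lY; rewrite tr_col (submx_trans _ sB) // row_sub.
Qed.

(** [G Y x - x] lies in the kernel of [Y], hence is orthogonal to [x]; so
    [|x|^2 = <x, G Y x> <= |x| g |Y x|]. *)
Lemma pseudo_inverse_row_lower (R : realType) n m (Y : 'M[R]_(n, m)) (G : 'M[R]_(m, n))
    (g : R) : 0 < g -> Y *m G *m Y = Y -> op_le G g -> row_lower Y g^-1.
Proof.
move=> g0 YGY Gg x /submxP[z ez]; rewrite ler_pdivrMl //.
apply: le_trans _ (Gg _); have [->|x0] := eqVneq x 0; first by rewrite frob_norm0 frob_norm_ge0.
rewrite -(ler_pM2l (_ : 0 < frob_norm x)) ?frob_norm_gt0 // -expr2 sqr_frob_norm.
apply: le_trans _ (inner_cauchy _ _).
have ex : x = Y^T *m z^T by rewrite -trmx_mul -ez trmxK.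
by rewrite {1}ex [in leRHS]ex !inner_mull trmxK -ex !mulmxA YGY.
Qed.

(* With [P], [Q] the orthogonal projectors on the row spaces of [Y] and [X], both [D]
   restricted to the range of [Q] and [Y] on that of [1 - Q] are compared with the
   projector products, and [tr (Q (1 - P)) <= tr (P (1 - Q))] as [tr Q <= tr P]. *)
Lemma low_rank_approx (R : realType) n m (X Y D : 'M[R]_(n, m)) (a : R) :
  (\rank X <= \rank Y)%N -> Y^T *m D = 0 -> D *m Y^T = 0 -> 0 <= a ->
  row_lower Y a -> op_le D a -> inner D D <= inner (Y + D - X) (Y + D - X).
Proof.
move=> rXY YD DY a0 lY Da.
have [P [PT PP YP sP trP]] := row_projector_ex Y.
have [Q [QT QQ XQ _ trQ]] := row_projector_ex X.
have [P'T P'P'] := proj_compl PT PP; have [Q'T Q'Q'] := proj_compl QT QQ.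
set P' := 1%:M - P in P'T P'P'; set Q' := 1%:M - Q in Q'T Q'Q'.
have Q'Q : Q' *m Q = 0 by rewrite /Q' mulmxBl mul1mx QQ subrr.
have DP' : D *m P' = D.
  rewrite /P' mulmxBr mulmx1 -PT; have /submxP[K ->] := sP.
  by rewrite trmx_mul mulmxA DY mul0mx subr0.
have eA (K : 'M[R]_(n, m)) : inner K K = inner (K *m Q) (K *m Q) + inner (K *m Q') (K *m Q').
  rewrite -inner_pythagoras; first by rewrite -mulmxDr /Q' addrC subrK mulmx1.
  by rewrite inner_mulr QT -mulmxA Q'Q mulmx0 inner0r.
have DQ : inner (D *m Q) (D *m Q) <= a ^+ 2 * (\tr Q - \tr (P *m Q)).
  have -> : \tr Q - \tr (P *m Q) = inner (P' *m Q) (P' *m Q).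
    by rewrite inner_proj_mul // /P' mulmxBl mul1mx linearB.
  rewrite -sqr_frob_norm -(sqr_frob_norm (P' *m Q)) -exprMn.
  rewrite ler_sqr ?nnegrE ?mulr_ge0 ?frob_norm_ge0 //.
  by rewrite -{1}DP' -mulmxA op_le_mx.
have YQ' : a ^+ 2 * (\tr P - \tr (P *m Q)) <= inner (Y *m Q') (Y *m Q').
  have -> : \tr P - \tr (P *m Q) = inner (P *m Q') (P *m Q').
    by rewrite inner_proj_mul // /Q' mulmxBr mulmx1 linearB.
  rewrite -(sqr_frob_norm (Y *m Q')) -(sqr_frob_norm (P *m Q')) -exprMn.
  rewrite ler_sqr ?nnegrE ?mulr_ge0 ?frob_norm_ge0 //.
  rewrite -{1}YP -mulmxA; apply: row_lower_mx => //.
  by rewrite trmx_mul PT mulmx_sub.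
have tQP : a ^+ 2 * (\tr Q - \tr (P *m Q)) <= a ^+ 2 * (\tr P - \tr (P *m Q)).
  by rewrite ler_wpM2l ?sqr_ge0 // lerD2r trP trQ ler_nat.
(* Right of [Q'] the matrix [X] vanishes and [Y], [D] give orthogonal terms, so [|Y Q'|^2] pays for
   [|D Q|^2]. *)
rewrite [leRHS]eA (eA D).
have XQ' : X *m Q' = 0 by rewrite /Q' mulmxBr mulmx1 XQ subrr.
have -> : (Y + D - X) *m Q' = Y *m Q' + D *m Q' by rewrite mulmxBl XQ' subr0 mulmxDl.
rewrite [inner (Y *m Q' + _) _]inner_pythagoras; last first.
  by rewrite inner_mul0l // mulmxA YD mul0mx.
have := inner_ge0 ((Y + D - X) *m Q); lra.
Qed.

(** [(a / b) D] still has operator bound [a], so [Y] is also nearest to [Y + (a / b) D]; this is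
    [h1]. Optimality of [Y'] for [A'] is [h2]. Together they leave
    [(1 - b / a) |Y - Y'|^2 <= 2 <E, Y' - Y>], and Cauchy-Schwarz concludes. *)
Lemma nearest_stable (R : realType) n m r (A A' Y Y' : 'M[R]_(n, m)) (a b : R) :
  0 < b -> b < a -> is_nearest_point (@rank_le R n m r) A Y ->
  is_nearest_point (@rank_le R n m r) A' Y' -> \rank Y = r ->
  row_lower Y a -> op_le (A - Y) b ->
  (1 - b / a) * frob_norm (Y - Y') <= 2 * frob_norm (A' - A).
Proof.
move=> b0 ba nY nY' rY lY Db; set D := A - Y in Db; set E := A' - A.
have a0 : 0 < a := lt_trans b0 ba.
have YD : Y^T *m D = 0 := nearest_trmul0 nY.
have DY : D *m Y^T = 0 := nearest_multr0 nY.
have t0 : 0 < a / b by rewrite divr_gt0.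
have h1 : 2 * inner D (Y' - Y) <= b / a * inner (Y - Y') (Y - Y').
  have := @low_rank_approx _ _ _ Y' Y ((a / b) *: D) a.
  rewrite rY -scalemxAr YD scaler0 -scalemxAl DY scaler0.
  move=> /(_ nY'.1 erefl erefl (ltW a0) lY) h.
  have {}h : inner (a / b *: D) (a / b *: D) <=
      inner (Y + a / b *: D - Y') (Y + a / b *: D - Y').
    apply: h => x; rewrite -scalemxAl /frob_norm innerZl innerZr mulrA -expr2.
    rewrite sqrtrM ?sqr_ge0 // sqrtr_sqr (ger0_norm (ltW t0)) -ler_pdivlMl //.
    by rewrite invf_div mulrA divfK ?gt_eqF //; apply: Db.
  have {}h : - (2 * (a / b * inner (Y - Y') D)) <= inner (Y - Y') (Y - Y').
    by move: h; rewrite addrAC [leRHS]inner_sqrD (innerZr _ (Y - Y')); lra.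
  rewrite -(ler_pM2l t0) [leRHS]mulrA -(invf_div a b) divff ?gt_eqF // mul1r.
  have -> : inner D (Y' - Y) = - inner (Y - Y') D by rewrite innerC -opprB innerNl.
  by move: h; clear; lra.
have h2 : inner (Y - Y') (Y - Y') <= 2 * inner D (Y' - Y) + 2 * inner E (Y' - Y).
  have := nearest_inner_le nY' (X := Y) nY.1.
  have -> : A' - Y = D + E by rewrite /D /E [RHS]addrC addrA subrK.
  have -> : A' - Y' = D + E - (Y' - Y) by rewrite /D /E; apply/matrixP => i j; rewrite !mxE; ring.
  rewrite [X in X <= _ -> _]inner_sqrD => h.
  rewrite !(innerNr _ (Y' - Y)) innerNl opprK (innerDl D E (Y' - Y)) in h.
  by rewrite -(opprB Y' Y) innerNl innerNr opprK; lra.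
have h3 := inner_cauchy E (Y' - Y).
have [->|K0] := eqVneq (Y - Y') 0; first by rewrite frob_norm0 mulr0 mulr_ge0 ?frob_norm_ge0.
rewrite -(ler_pM2r (_ : 0 < frob_norm (Y - Y'))) ?frob_norm_gt0 //.
rewrite -(frob_normB Y Y') in h3.
have e := sqr_frob_norm (Y - Y').
rewrite -mulrA -expr2 e; lra.
Qed.

(** * Tangent projections *)

(** Regrouped as [P K + (1 - P) K Q], it has two terms of size at most [s]. *)
Lemma op_le_tangent (R : realType) n m (P : 'M[R]_n) (Q : 'M[R]_m) (K : 'M[R]_(n, m)) (s : R) :
  P^T = P -> P *m P = P -> Q^T = Q -> Q *m Q = Q -> 0 <= s ->
  op_le K s -> op_le (P *m K + K *m Q - P *m K *m Q) (2 * s).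
Proof.
move=> PT PP QT QQ s0 Ks.
have -> : P *m K + K *m Q - P *m K *m Q = P *m K + (1%:M - P) *m K *m Q.
  by rewrite -addrA !mulmxBl mul1mx.
have -> : 2 * s = 1 * s + 1 * s * 1 by ring.
apply: op_leD; first by apply: op_leM => //; apply: op_le_proj.
apply: op_leM (op_le_proj QT QQ); first by rewrite mul1r.
exact: op_leM (op_le_subproj PT PP) Ks.
Qed.

Lemma op_le_normal (R : realType) n m (P : 'M[R]_n) (Q : 'M[R]_m) (K : 'M[R]_(n, m)) (s : R) :
  P^T = P -> P *m P = P -> Q^T = Q -> Q *m Q = Q -> 0 <= s ->
  op_le K s -> op_le ((1%:M - P) *m K *m (1%:M - Q)) s.
Proof.
move=> PT PP QT QQ s0 Ks; rewrite -[s]mulr1; apply: op_leM (op_le_subproj QT QQ) => //.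
rewrite -[s]mul1r; exact: op_leM (op_le_subproj PT PP) Ks.
Qed.

Lemma frob_norm_tangent (R : realType) n m (P : 'M[R]_n) (Q : 'M[R]_m) (K : 'M[R]_(n, m)) :
  P^T = P -> P *m P = P -> Q^T = Q -> Q *m Q = Q ->
  frob_norm (P *m K + K *m Q - P *m K *m Q) <= 2 * frob_norm K.
Proof.
move=> PT PP QT QQ.
have -> : P *m K + K *m Q - P *m K *m Q = P *m K + (1%:M - P) *m (K *m Q).
  by rewrite -addrA !mulmxBl mul1mx mulmxA.
have KQ : frob_norm (K *m Q) <= frob_norm K.
  rewrite -frob_norm_tr trmx_mul QT -(frob_norm_tr K) -[leRHS]mul1r.
  by apply: op_le_mx => //; apply: op_le_proj.
apply: le_trans (frob_normD _ _) _.
have h1 : frob_norm (P *m K) <= 1 * frob_norm K by apply: op_le_mx => //; apply: op_le_proj.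
have h2 : frob_norm ((1%:M - P) *m (K *m Q)) <= 1 * frob_norm (K *m Q).
  by apply: op_le_mx => //; apply: op_le_subproj.
lra.
Qed.

Lemma tangent_projectors (R : realType) n m r (X : 'M[R]_(n, m)) (T : set 'M[R]_(n, m)) :
  is_tangent_space r X T ->
  exists (P : 'M[R]_n) (Q : 'M[R]_m),
    [/\ P^T = P /\ P *m P = P, Q^T = Q /\ Q *m Q = Q, P *m X = X, X *m Q = X &
        forall Z, orth_proj T Z = P *m Z + Z *m Q - P *m Z *m Q].
Proof.
case=> U [V [UU VV /submxP[K eX] /submxP[L eX'] ->]].
have proj k (W : 'M[R]_(k, r)) : W^T *m W = 1%:M ->
    (W *m W^T)^T = W *m W^T /\ W *m W^T *m (W *m W^T) = W *m W^T.
  by move=> WW; rewrite trmx_mul trmxK mulmxA -(mulmxA W) WW mulmx1.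
exists (U *m U^T), (V *m V^T); split; try exact: proj.
- have {}eX : X = U *m K^T by rewrite -[X]trmxK eX trmx_mul trmxK.
  by rewrite eX mulmxA -(mulmxA U) UU mulmx1.
- by rewrite eX' -!mulmxA (mulmxA V^T) VV mul1mx.
- by move=> Z; rewrite orth_proj_tangent // !mulmxA.
Qed.

(** * Singular values *)

Section SymmetricSpectral.

Local Open Scope sesquilinear_scope.

(** Obtained from the hermitian spectral theorem over [R[i]]. The [w i] are the squared moduli of
    the coordinates of [x] in a unitary eigenbasis, the same for all [k]; these moments spare later
    arguments any complex eigenvector. *)
Lemma symmetric_spectral (R : realType) m (A : 'M[R]_m) : A^T = A ->
  exists2 d : 'rV[R]_m,
    char_poly A = \prod_i ('X - (d 0 i)%:P) /\ \rank A = \rank (diag_mx d) &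
    forall x : 'cV_m, exists2 w : 'I_m -> R, forall i, 0 <= w i &
      forall k, inner x (iter k (mulmx A) x) = \sum_i d 0 i ^+ k * w i.
Proof.
move=> AT; pose f : {rmorphism R -> R[i]} := real_complex R; set M := map_mx f A.
have conjR (a : R) : Num.conj (f a) = f a.
  by apply/conj_Creal; rewrite complex_real.
have Mh : M \is hermsymmx.
  apply/is_hermitianmxP; rewrite expr0 scale1r; apply/matrixP => i j.
  by rewrite !mxE conjR -[in RHS]AT mxE.
have := hermitian_spectral_diag_real Mh.
have /hermitian_normalmx/orthomx_spectralP := Mh.
have := spectral_unitarymx M.
move: (spectralmx M) (spectral_diag M) => P D PU MD /mxOverP Dr.
pose d := map_mx (@complex.Re R) D.
have Dd : D = map_mx f d.
  by apply/matrixP => i j; rewrite !mxE; apply/esym/RRe_real/Dr.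
have Pu : P \in unitmx := unitarymx_unit PU.
have PM : P *m M = diag_mx D *m P by rewrite MD !mulmxA mulmxV // mul1mx.
exists d; first split.
- apply: (map_poly_inj f); rewrite map_char_poly -/M.
  have -> : char_poly M = char_poly (diag_mx D).
    have e : char_poly_mx M = map_mx polyC (invmx P) *m char_poly_mx (diag_mx D)
        *m map_mx polyC P.
      rewrite /char_poly_mx mulmxBr mulmxBl -!map_mxM -MD; congr (_ - _).
      by rewrite mul_mx_scalar -scalemxAl -map_mxM mulVmx // map_mx1 scalemx1.
    rewrite /char_poly e !det_mulmx mulrC mulrA -det_mulmx -map_mxM mulmxV //.
    by rewrite map_mx1 det1 mul1r.
  rewrite char_poly_trig ?diag_mx_is_trig // rmorph_prod.
  apply: eq_bigr => i _; rewrite rmorphB /= map_polyX map_polyC /=.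
  by rewrite mxE eqxx mulr1n Dd mxE.
- rewrite -(mxrank_map f) -/M -(mxrank_map f (diag_mx d)) map_diag_mx -Dd.
  rewrite MD mxrankMfree ?row_free_unit // (eqmxMfull (diag_mx D)) //.
  by rewrite row_full_unit unitmx_inv.
move=> x; set y := P *m map_mx f x.
exists (fun i => complex.Re (`|y i 0| ^+ 2)).
  move=> i; rewrite -lecR RRe_real ?rpredX ?normr_real //.
  exact: exprn_ge0.
move=> k; apply: complexI; rewrite -/f.
have Pk i : (P *m map_mx f (iter k (mulmx A) x)) i 0 = D 0 i ^+ k * y i 0.
  elim: k => [|k IH] /=; first by rewrite expr0 mul1r.
  rewrite map_mxM mulmxA PM -mulmxA mul_diag_mx mxE IH.
  by rewrite exprS mulrA.
set u := iter k _ x in Pk *.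
have -> : f (inner x u) = ((map_mx f x)^t* *m map_mx f u) 0 0.
  rewrite /inner /mxtrace big_ord1 !mxE rmorph_sum; apply: eq_bigr => i _.
  by rewrite !mxE rmorphM /= conjR.
have -> : (map_mx f x)^t* *m map_mx f u = y^t* *m (P *m map_mx f u).
  rewrite /y trmx_mul map_mxM mulmxA -(mulmxA _ (P^t*)) -invmx_unitary //.
  by rewrite mulVmx // mulmx1.
rewrite mxE rmorph_sum; apply: eq_bigr => i _.
have Di : f (d 0 i) = D 0 i by rewrite [in RHS]Dd [RHS]mxE.
rewrite Pk mxE [in LHS]mxE rmorphM rmorphXn /= Di mulrCA; congr (_ * _).
have -> : f (complex.Re (`|y i 0| ^+ 2)) = `|y i 0| ^+ 2.
  by apply: RRe_real; rewrite rpredX ?normr_real.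
by rewrite normCK mulrC !mxE.
Qed.

End SymmetricSpectral.

(** The indicator [e] of the nonzero entries gives an orthogonal projector of the same rank, and its
    trace counts them. *)
Lemma rank_diag_mx (R : realType) m (d : 'rV[R]_m) :
  \rank (diag_mx d) = #|[pred i | d 0 i != 0]|.
Proof.
pose e := \row_i (d 0 i != 0)%:R : 'rV[R]_m.
pose d' := \row_i (d 0 i)^-1 : 'rV[R]_m.
have ee : diag_mx e *m diag_mx e = diag_mx e.
  rewrite mulmx_diag; congr diag_mx; apply/rowP => i; rewrite !mxE.
  by case: (_ == _); rewrite ?mulr0 ?mulr1.
have -> : \rank (diag_mx d) = \rank (diag_mx e).
  apply/eqP; rewrite eqn_leq; apply/andP; split.
    have -> : diag_mx d = diag_mx d *m diag_mx e.
      rewrite mulmx_diag; congr diag_mx; apply/rowP => i; rewrite !mxE.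
      by have [->|] := eqVneq (d 0 i) 0; rewrite ?mulr0 ?mulr1.
    exact: mxrankM_maxr.
  have -> : diag_mx e = diag_mx d' *m diag_mx d.
    rewrite mulmx_diag; congr diag_mx; apply/rowP => i; rewrite !mxE.
    by have [->|d0] := eqVneq (d 0 i) 0; rewrite ?mulr0 // mulVf.
  exact: mxrankM_maxr.
have [Q [QT QQ eQ /submxP[K eK] trQ]] := row_projector_ex (diag_mx e).
have Qe : Q *m diag_mx e = Q by rewrite eK -mulmxA ee.
have {}eQ : diag_mx e = Q.
  by rewrite -eQ -[LHS]trmxK trmx_mul tr_diag_mx QT Qe.
apply/eqP; rewrite -(eqr_nat R) -trQ -eQ mxtrace_diag -sum1_card natr_sum.
rewrite [X in _ == X]big_mkcond /=; apply/eqP/eq_bigr => i _.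
by rewrite mxE inE; case: (_ != _).
Qed.

(** Once the polynomial splits, sorting the [d 0 i] provides a witness for [xget], so its default is
    not taken. *)
Lemma eigenvaluesP (R : realType) m (A : 'M[R]_m) (d : 'rV[R]_m) :
  char_poly A = \prod_i ('X - (d 0 i)%:P) ->
  sorted >=%R (eigenvalues A) /\ perm_eq (eigenvalues A) [seq d 0 i | i <- enum 'I_m].
Proof.
move=> Ad; set s := [seq d 0 i | i <- enum 'I_m].
have es : char_poly A = \prod_(a <- s) ('X - a%:P).
  by rewrite Ad big_map big_enum.
have : [set s : seq R | sorted >=%R s /\ char_poly A = \prod_(a <- s) ('X - a%:P)]
    (eigenvalues A).
  apply: (xgetPex [::]); exists (sort >=%R s); split.
    by apply: sort_sorted => a b; apply: le_total.
  by rewrite es; apply/perm_big; rewrite perm_sym perm_sort.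
by case=> -> /=; rewrite es => /prod_XsubC_eq; rewrite perm_sym.
Qed.

Lemma gram_eigenvector (R : realType) n m (X : 'M[R]_(n, m)) (a : R) :
  root (char_poly (X^T *m X)) a ->
  exists2 v : 'cV_m, v != 0 & inner (X *m v) (X *m v) = a * inner v v.
Proof.
rewrite -eigenvalue_root_char => /eigenvalueP[u uX u0]; exists u^T.
  by apply: contra u0 => /eqP e; rewrite -[u]trmxK e trmx0.
by rewrite /inner trmx_mul trmxK mulmxA -(mulmxA u) uX -scalemxAl mxtraceZ.
Qed.

Lemma gram_eigenvalue_ge0 (R : realType) n m (X : 'M[R]_(n, m)) (a : R) :
  root (char_poly (X^T *m X)) a -> 0 <= a.
Proof.
move=> /gram_eigenvector[v v0 e].
by rewrite -(pmulr_lge0 a (_ : 0 < inner v v)) ?inner_gt0 // -e inner_ge0.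
Qed.

Lemma inner_gram (R : realType) n m (X : 'M[R]_(n, m)) (x : 'cV[R]_m) :
  inner (X *m x) (X *m x) = inner x (X^T *m X *m x).
Proof. by rewrite inner_mull mulmxA. Qed.

Lemma sp_norm_ge0 (R : realType) n m (X : 'M[R]_(n, m)) : 0 <= sp_norm X.
Proof. exact: sqrtr_ge0. Qed.

Lemma root_char_poly_diag (R : realType) m (A : 'M[R]_m) (d : 'rV[R]_m) i :
  char_poly A = \prod_i ('X - (d 0 i)%:P) -> root (char_poly A) (d 0 i).
Proof.
by move=> ->; rewrite (bigD1 i) //= rootM root_XsubC eqxx.
Qed.

Lemma gram_sym (R : realType) n m (X : 'M[R]_(n, m)) : (X^T *m X)^T = X^T *m X.
Proof. by rewrite trmx_mul trmxK. Qed.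

Lemma op_le_sp_norm (R : realType) n m (X : 'M[R]_(n, m)) : op_le X (sp_norm X).
Proof.
move=> x; have [d [cA _] /(_ x)[w w0 mom]] := symmetric_spectral (gram_sym X).
have [srt prm] := eigenvaluesP cA.
set s := eigenvalues _ in srt prm.
have d0 i : 0 <= d 0 i by apply: gram_eigenvalue_ge0 (root_char_poly_diag i cA).
have ds i : d 0 i <= nth 0 s 0.
  have : d 0 i \in s by rewrite (perm_mem prm) map_f // mem_enum.
  move=> /(nthP 0)[k ks <-].
  apply: (sorted_leq_nth ge_trans ge_refl) => //; rewrite inE.
  exact: leq_ltn_trans ks.
rewrite frob_norm_leP ?mulr_ge0 ?sp_norm_ge0 ?frob_norm_ge0 //.
(* [|X x|^2] and [|x|^2] are the moments of order 1 and 0. *)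
rewrite exprMn sqr_frob_norm inner_gram (mom 1%N) (mom 0%N).
rewrite mulr_sumr; apply: ler_sum => i _; rewrite mul1r expr1.
by rewrite ler_wpM2r // /sp_norm /sing_val -/s sqr_sqrtr // (le_trans (d0 i)).
Qed.

Lemma sp_norm_le (R : realType) n m (X : 'M[R]_(n, m)) (s : R) :
  0 <= s -> op_le X s -> sp_norm X <= s.
Proof.
move=> s0 Xs; rewrite /sp_norm /sing_val /=; set e := eigenvalues _.
have [d [cA _] _] := symmetric_spectral (gram_sym X).
have [_ prm] := eigenvaluesP cA; rewrite -/e in prm.
(* The list is empty only for [m = 0]; [nth] then returns its default 0. *)
case E : e => [|a t]; first by rewrite sqrtr0.
have : a \in e by rewrite E mem_head.
rewrite (perm_mem prm) => /mapP[i _ /= ->].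
have /gram_eigenvector[v v0 ev] := root_char_poly_diag i cA.
rewrite -(ger0_norm s0) -sqrtr_sqr ler_wsqrtr //.
rewrite -(ler_pM2r (_ : 0 < inner v v)) ?inner_gt0 // -ev.
by rewrite -(sqr_frob_norm v) -exprMn -frob_norm_leP ?mulr_ge0 ?frob_norm_ge0.
Qed.

Lemma gram_row_sub (R : realType) n m (X : 'M[R]_(n, m)) : (X <= X^T *m X)%MS.
Proof.
rewrite submxE; apply/eqP/inner_eq0; rewrite inner_mull mulmxA.
by rewrite mulmx_coker inner0r.
Qed.

(** The first [r] eigenvalues of the Gram matrix are at least [lam > 0], while its rank is at most
    [r]; hence all others vanish. *)
Lemma sing_val_row_lower (R : realType) n m r (X : 'M[R]_(n, m)) :
  (0 < r)%N -> (\rank X <= r)%N -> 0 < sing_val r X ->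
  \rank X = r /\ row_lower X (sing_val r X).
Proof.
move=> r0 rX; set A := X^T *m X.
have [d [cA rA] mom] := symmetric_spectral (gram_sym X).
have [srt prm] := eigenvaluesP cA; rewrite /sing_val -/A.
set s := eigenvalues _ in srt prm *; set lam := nth 0 s r.-1.
rewrite sqrtr_gt0 => lam0.
have d0 i : 0 <= d 0 i by apply: gram_eigenvalue_ge0 (root_char_poly_diag i cA).
(* [lam] sits at index [r.-1]; past the end of [s] it would be the default 0. *)
have rs : (r <= size s)%N.
  rewrite -(prednK r0) ltnNge; apply/negP => h.
  by rewrite /lam nth_default // ltxx in lam0.
have rAX : (\rank A <= \rank X)%N by apply: mxrankM_maxr.
pose nz : pred R := [pred a | a != 0].
have cnt : count nz s = \rank A.
  rewrite -/A in rA; rewrite rA rank_diag_mx (permP prm) count_map.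
  by rewrite -size_filter cardE enumT; congr (size _); apply: eq_filter.
have lamle k : (k < r)%N -> lam <= nth 0 s k.
  move=> kr; apply: (sorted_leq_nth ge_trans ge_refl) => //; rewrite ?inE.
  - exact: leq_trans rs.
  - by rewrite prednK.
  - by rewrite -ltnS prednK.
have ctake : count nz (take r s) = r.
  rewrite -[RHS](size_takel rs); apply/eqP; rewrite -all_count.
  apply/(all_nthP 0) => k; rewrite size_takel // => kr /=.
  by rewrite nth_take // /nz /= gt_eqF // (lt_le_trans lam0) // lamle.
have cdrop : count nz s = (r + count nz (drop r s))%N.
  by rewrite -{1}(cat_take_drop r s) count_cat ctake.
split; first by apply/eqP; rewrite eqn_leq rX (leq_trans _ rAX) // -cnt cdrop leq_addr.
have dlam i : d 0 i = 0 \/ lam <= d 0 i.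
  have [->|di0] := eqVneq (d 0 i) 0; [by left|right].
  have : d 0 i \in s by rewrite (perm_mem prm) map_f // mem_enum.
  rewrite -{1}(cat_take_drop r s) mem_cat => /orP[].
    move=> /(nthP 0)[k]; rewrite size_takel // => kr <-.
    by rewrite nth_take // lamle.
  move=> h; have : has nz (drop r s) by apply/hasP; exists (d 0 i).
  rewrite has_count => h1; move: rX; rewrite leqNgt; case/negP.
  by apply: leq_trans _ rAX; rewrite -cnt cdrop -addn1 leq_add2l.
move=> x sx; have [z ez] : exists z : 'cV_m, x = A *m z.
  have /submxP[u eu] := submx_trans sx (gram_row_sub X).
  by exists u^T; rewrite -[x]trmxK eu trmx_mul /A gram_sym.
have [w w0 mz] := mom z.
have AS (u v : 'cV_m) : inner (A *m u) v = inner u (A *m v).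
  by rewrite inner_mull /A gram_sym.
rewrite -ler_sqr ?nnegrE ?mulr_ge0 ?sqrtr_ge0 ?frob_norm_ge0 //.
rewrite exprMn !sqr_frob_norm sqr_sqrtr ?(ltW lam0) // inner_gram -/A ez !AS.
(* For [x = A z], [|x|^2] and [|X x|^2] are the second and third moments of [z]; writing [x] this
   way removes the zero eigenvalues. *)
rewrite (mz 2%N) (mz 3%N) mulr_sumr; apply: ler_sum => i _.
rewrite mulrA ler_wpM2r // [leRHS]exprS.
have [->|h] := dlam i; first by rewrite expr0n mulr0 mul0r.
by rewrite ler_wpM2r // sqr_ge0.
Qed.

(** On the row space of [X], [|Y x| >= |X x| - |(Y - X) x| >= (s - e) |x|], which feeds
    [pseudo_inverse_ex] with a row basis of [X]. *)
Lemma pseudo_inverse_near (R : realType) n m r (X Y : 'M[R]_(n, m)) (s e : R) :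
  e < s -> \rank X = r -> row_lower X s -> (\rank Y <= r)%N ->
  frob_norm (Y - X) <= e ->
  \rank Y = r /\ exists2 G, Y *m G *m Y = Y & op_le G (s - e)^-1.
Proof.
move=> es rX lX rY YX; apply: (pseudo_inverse_ex (B := castmx (rX, erefl m) (row_base X))).
- by rewrite subr_gt0.
- exact: rY.
- by case: r / rX rY; rewrite castmx_id row_base_free.
move=> x; have -> : (x^T <= castmx (rX, erefl m) (row_base X))%MS = (x^T <= X)%MS.
  by case: r / rX rY; rewrite castmx_id eq_row_base.
move=> /lX h; have h1 := op_leW YX (op_le_frob (Y - X)) x.
have : X *m x = Y *m x - (Y - X) *m x by rewrite mulmxBl opprB addrC subrK.
move=> e1; have := frob_normD (Y *m x) (- ((Y - X) *m x)).
rewrite -e1 frob_normN mulrBl; lra.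
Qed.

(** * Bounds for [orth_proj] on a tangent space and its normal residual *)

Lemma orth_proj_complE (R : realType) n m (P : 'M[R]_n) (Q : 'M[R]_m) (K : 'M[R]_(n, m)) :
  K - (P *m K + K *m Q - P *m K *m Q) = (1%:M - P) *m K *m (1%:M - Q).
Proof.
rewrite !mulmxBl !mulmxBr !mul1mx !mulmx1.
by apply/matrixP => i j; rewrite !mxE; ring.
Qed.

Section TangentProjection.

Context {R : realType} {n m r : nat} {X : 'M[R]_(n, m)} {T : set 'M[R]_(n, m)}.
Hypothesis tX : is_tangent_space r X T.

Lemma orth_projB (Z W : 'M[R]_(n, m)) :
  orth_proj T (Z - W) = orth_proj T Z - orth_proj T W.
Proof.
have [P [Q [_ _ _ _ E]]] := tangent_projectors tX; rewrite !E !mulmxBr !mulmxBl.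
by apply/matrixP => i j; rewrite !mxE; ring.
Qed.

Lemma orth_proj_base : orth_proj T X = X.
Proof.
have [P [Q [_ _ PX XQ E]]] := tangent_projectors tX.
by rewrite E PX XQ addrK.
Qed.

Lemma op_le_orth_proj (K : 'M[R]_(n, m)) s :
  0 <= s -> op_le K s -> op_le (orth_proj T K) (2 * s).
Proof.
have [P [Q [[PT PP] [QT QQ] _ _ E]]] := tangent_projectors tX.
by move=> s0 Ks; rewrite E; apply: op_le_tangent.
Qed.

Lemma frob_norm_orth_proj (K : 'M[R]_(n, m)) :
  frob_norm (orth_proj T K) <= 2 * frob_norm K.
Proof.
have [P [Q [[PT PP] [QT QQ] _ _ E]]] := tangent_projectors tX.
by rewrite E; apply: frob_norm_tangent.
Qed.

Lemma op_le_orth_proj_compl (K : 'M[R]_(n, m)) s :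
  0 <= s -> op_le K s -> op_le (K - orth_proj T K) s.
Proof.
have [P [Q [[PT PP] [QT QQ] _ _ E]]] := tangent_projectors tX.
by move=> s0 Ks; rewrite E orth_proj_complE; apply: op_le_normal.
Qed.

Lemma orth_proj_compl_normal (K : 'M[R]_(n, m)) :
  X^T *m (K - orth_proj T K) = 0 /\ (K - orth_proj T K) *m X^T = 0.
Proof.
have [P [Q [[PT PP] [QT QQ] PX XQ E]]] := tangent_projectors tX.
have XP : X^T *m P = X^T by rewrite -PT -trmx_mul PX.
have QX : Q *m X^T = X^T by rewrite -QT -trmx_mul XQ.
rewrite E orth_proj_complE; split.
  by rewrite !mulmxA (mulmxBr X^T) mulmx1 XP subrr !mul0mx.
by rewrite -mulmxA (mulmxBl _ _ X^T) mul1mx QX subrr mulmx0.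
Qed.

End TangentProjection.

(** * One step of the projected iteration *)

Section RetractionStep.

Context {R : realType} {n m r : nat} {X Z Y : 'M[R]_(n, m)} {T : set 'M[R]_(n, m)}.
Hypotheses (rX : (\rank X <= r)%N) (tX : is_tangent_space r X T)
  (nY : is_nearest_point (@rank_le R n m r) (orth_proj T Z) Y).

Lemma orth_proj_step_compl : op_le (Z - orth_proj T Z) (sp_norm (Z - X)).
Proof.
have -> : Z - orth_proj T Z = (Z - X) - orth_proj T (Z - X).
  by rewrite (orth_projB tX) (orth_proj_base tX) opprB addrA subrK.
by apply: op_le_orth_proj_compl tX _ _ (sp_norm_ge0 _) (op_le_sp_norm _).
Qed.

Lemma nearest_step_op_le : op_le (orth_proj T Z - Y) (2 * sp_norm (Z - X)).
Proof.
apply: nearest_op_le nY rX _ _; first by rewrite mulr_ge0 ?sp_norm_ge0.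
rewrite -[X in op_le (_ - X)](orth_proj_base tX) -(orth_projB tX).
by apply: op_le_orth_proj tX _ _ (sp_norm_ge0 _) (op_le_sp_norm _).
Qed.

Lemma step_sp_norm_le : sp_norm (Z - Y) <= 3 * sp_norm (Z - X).
Proof.
apply: sp_norm_le; first by rewrite mulr_ge0 ?sp_norm_ge0.
have -> : Z - Y = (Z - orth_proj T Z) + (orth_proj T Z - Y) by rewrite addrA subrK.
have -> : 3 * sp_norm (Z - X) = sp_norm (Z - X) + 2 * sp_norm (Z - X) by ring.
exact: op_leD orth_proj_step_compl nearest_step_op_le.
Qed.

(** Splitting [Z - Y = (Z - A) + (A - Y)] yields four terms: [<Y, A - Y>] is zero, the others are
    quadratic by [inner_normal_le]. In units of [M g] they cost [2 |Xhat - Y|^2], [|Xhat - X|^2] and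
    [|Y - X|^2]; the last is at most twice the sum of the other two squares, whence 4 and 3. *)
Lemma step_inner_le (Xhat : 'M[R]_(n, m)) (G H : 'M[R]_(m, n)) (g : R) :
  0 <= g -> op_le G g -> op_le H g ->
  Xhat *m G *m Xhat = Xhat -> Y *m H *m Y = Y ->
  inner (Xhat - Y) (Z - Y) <=
    sp_norm (Z - X) * g * (4 * frob_norm (Xhat - Y) ^+ 2 + 3 * frob_norm (Xhat - X) ^+ 2).
Proof.
move=> g0 Gg Hg XGX YHY; set A := orth_proj T Z; set M := sp_norm _.
have M0 : 0 <= M := sp_norm_ge0 _.
have YD : Y^T *m (A - Y) = 0 := nearest_trmul0 nY.
have DY : (A - Y) *m Y^T = 0 := nearest_multr0 nY.
have [XE EX] := orth_proj_compl_normal tX Z.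
have Ee := orth_proj_step_compl; rewrite -/A -/M in XE EX Ee.
have := nearest_step_op_le; rewrite -/A -/M => Dd.
have h1 := inner_normal_le XGX YD DY (mulr_ge0 (ler0n _ 2) M0) g0 Dd Gg.
have h2 := inner_normal_le XGX XE EX M0 g0 Ee Gg.
have h3 : inner Y (- (Z - A)) <= M * g * frob_norm (Y - X) ^+ 2.
  by apply: inner_normal_le YHY _ _ M0 g0 (op_leN Ee) Hg; rewrite ?mulmxN ?mulNmx ?XE ?EX oppr0.
have h4 : inner Y (A - Y) = 0 by rewrite /inner YD mxtrace0.
have h5 : frob_norm (Y - X) ^+ 2 <=
    2 * (frob_norm (Xhat - Y) ^+ 2 + frob_norm (Xhat - X) ^+ 2).
  rewrite !sqr_frob_norm.
  have -> : Y - X = (Xhat - X) + - (Xhat - Y) by rewrite opprB [RHS]addrC addrA subrK.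
  move: (Xhat - X) (Xhat - Y) => V W; have := inner_ge0 (V + W).
  by rewrite !inner_sqrD !innerNl !innerNr; lra.
have h6 := ler_wpM2l (mulr_ge0 M0 g0) h5.
have -> : inner (Xhat - Y) (Z - Y) =
    inner Xhat (A - Y) + inner Xhat (Z - A) + inner Y (- (Z - A)) - inner Y (A - Y).
  have -> : Z - Y = (Z - A) + (A - Y) by rewrite addrA subrK.
  by rewrite innerDl innerNl !(innerDr (Z - A) (A - Y)) innerNr; ring.
by rewrite h4; move: h1 h2 h3 h6; lra.
Qed.

End RetractionStep.

Lemma step_stable (R : realType) n m r (Xhat X Z W Y Y' : 'M[R]_(n, m))
    (T : set 'M[R]_(n, m)) (s : R) :
  0 < s -> \rank Xhat = r -> row_lower Xhat s ->
  is_tangent_space r X T -> (\rank X <= r)%N ->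
  is_nearest_point (@rank_le R n m r) (orth_proj T Z) Y ->
  is_nearest_point (@rank_le R n m r) (orth_proj T W) Y' ->
  frob_norm (X - Xhat) <= s / 4 -> frob_norm (Y - Xhat) <= s / 4 ->
  sp_norm (Z - Y) <= s / 24 ->
  frob_norm (Y - Y') <= 18 * frob_norm (Z - W).
Proof.
move=> s0 rXhat lXhat tX rX nY nY' bX bY ZY.
have s4 : s / 4 < s by lra.
have [rY [G YGY Gg]] := pseudo_inverse_near s4 rXhat lXhat nY.1 bY.
have g0 : 0 < (s - s / 4)^-1 by rewrite invr_gt0; lra.
have lY := pseudo_inverse_row_lower g0 YGY Gg; rewrite invrK in lY.
have YX : op_le (Y - X) (s / 2).
  apply: op_leW (op_le_frob _).
  have -> : Y - X = (Y - Xhat) + - (X - Xhat) by rewrite opprB addrA subrK.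
  by apply: le_trans (frob_normD _ _) _; rewrite frob_normN; lra.
have Db : op_le (orth_proj T Z - Y) (7 / 12 * s).
  (* As the projection fixes [X], only the normal part of [Y - X] appears besides the image of
     [Z - Y]. *)
  have -> : orth_proj T Z - Y =
      orth_proj T (Z - Y) + - ((Y - X) - orth_proj T (Y - X)).
    rewrite !(orth_projB tX) (orth_proj_base tX).
    by apply/matrixP => i j; rewrite !mxE; ring.
  have -> : 7 / 12 * s = 2 * (s / 24) + s / 2 by field.
  apply: op_leD.
    apply: (op_le_orth_proj tX); first by lra.
    exact: op_leW ZY (op_le_sp_norm _).
  by apply/op_leN/(op_le_orth_proj_compl tX) => //; lra.
have b0 : 0 < 7 / 12 * s by lra.
have ba : 7 / 12 * s < s - s / 4 by lra.
have := nearest_stable b0 ba nY nY' rY lY Db.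
rewrite -(orth_projB tX).
have := frob_norm_orth_proj tX (W - Z); rewrite (frob_normB W Z).
(* Projecting [W - Z] costs a factor 2 and [nearest_stable] another 2, so the Lipschitz constant is
   [4 / (2 / 9) = 18]. *)
have -> : 1 - 7 / 12 * s / (s - s / 4) = 2 / 9.
  have -> : s - s / 4 = 3 / 4 * s by field.
  by field; rewrite gt_eqF.
lra.
Qed.

(** * Inner product condition, norm compatibility and local continuity *)

Theorem lemma8 (R : realType) (n m r : nat) (hr : (1 <= r < minn n m)%N)
    (Xhat : 'M[R]_(n, m)) (hXhat : rank_le r Xhat)
    (hsigma : 0 < sing_val r Xhat)
    (PC : 'M[R]_(n, m) -> 'M[R]_(n, m))
    (hPC : forall Z, is_nearest_point (rank_le r) Z (PC Z))
    (T : 'M[R]_(n, m) -> set 'M[R]_(n, m))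
    (hT : forall X, rank_le r X -> is_tangent_space r X (T X)) :
  let P := fun X Z : 'M[R]_(n, m) => PC (orth_proj (T X) Z) in
  let rho : R := sing_val r Xhat / 4 in
  let gammac : R := 6 / sing_val r Xhat in
  let gammad : R := 6 / sing_val r Xhat in
  let phi : R := 3 in
  [/\ forall X Z : 'M[R]_(n, m),
        rank_le r X -> frob_ball Xhat rho X -> frob_ball Xhat rho (P X Z) ->
        inner (Xhat - P X Z) (Z - P X Z) <=
          Num.max (sp_norm (Z - P X Z)) (sp_norm (Z - X)) *
            (gammac * frob_norm (Xhat - P X Z) ^+ 2 +
             gammad * frob_norm (Xhat - X) ^+ 2),
      forall X Z : 'M[R]_(n, m),
        rank_le r X -> frob_ball Xhat rho X ->
        sp_norm (Z - P X Z) <= phi * sp_norm (Z - X)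
    & forall c0 : R, 0 < c0 ->
      forall X : 'M[R]_(n, m), rank_le r X -> frob_ball Xhat rho X ->
      forall eps : R, 0 < eps ->
      exists2 delta : R, 0 < delta &
        forall Z W : 'M[R]_(n, m),
          frob_ball Xhat rho (P X Z) ->
          2 * (gammac + gammad) * sp_norm (Z - P X Z) <= 1 - c0 ->
          frob_norm (Z - W) <= delta ->
          frob_norm (P X Z - P X W) <= eps].
Proof.
have r0 : (0 < r)%N by case/andP: hr.
have [rXhat lXhat] := sing_val_row_lower r0 hXhat hsigma.
set s := sing_val r Xhat in hsigma lXhat *; move=> P rho gammac gammad phi.
have s4 : s / 4 < s by lra.
have rho0 : frob_norm (Xhat - Xhat) <= s / 4 by rewrite subrr frob_norm0; lra.
have gs : (s - s / 4)^-1 = 4 / 3 / s.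
  have -> : s - s / 4 = 3 / 4 * s by field.
  by field; rewrite gt_eqF.
have g0 : 0 <= 4 / 3 / s by rewrite divr_ge0 // ?ltW //; lra.
split.
- move=> X Z rX bX bY; have tX := hT _ rX; have nY := hPC (orth_proj (T X) Z).
  have [_ [G XGX Gg]] := pseudo_inverse_near s4 rXhat lXhat hXhat rho0.
  have [_ [H YHY Hg]] := pseudo_inverse_near s4 rXhat lXhat nY.1 bY.
  rewrite gs in Gg Hg.
  apply: le_trans (step_inner_le rX tX nY g0 Gg Hg XGX YHY) _.
  set M := Num.max _ _; set a := frob_norm _ ^+ 2; set b := frob_norm _ ^+ 2.
  have a0 : 0 <= a by rewrite sqr_ge0.
  have b0 : 0 <= b by rewrite sqr_ge0.
  have ZM : sp_norm (Z - X) <= M by rewrite le_max lexx orbT.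
  have -> : gammac * a + gammad * b = 6 / s * (a + b) by rewrite mulrDr.
  rewrite -mulrA; apply: ler_pM => //; first exact: sp_norm_ge0.
    by apply: mulr_ge0 => //; lra.
  (* The coefficients are [4 / 3 * 4 = 16 / 3] and [4 / 3 * 3 = 4], both at most 6. *)
  rewrite [leLHS]mulrAC [leRHS]mulrAC ler_wpM2r ?invr_ge0 ?(ltW hsigma) //; lra.
- move=> X Z rX _; exact: step_sp_norm_le rX (hT _ rX) (hPC _).
- move=> c0 c00 X rX bX eps eps0; exists (eps / 18); first by rewrite divr_gt0.
  move=> Z W bY hZ ZW; apply: (@le_trans _ _ (18 * frob_norm (Z - W))); last by lra.
  apply: (step_stable hsigma rXhat lXhat (hT _ rX) rX (hPC _) (hPC _) bX bY).
  (* So the hypothesis reads [sp_norm (Z - P X Z) <= (1 - c0) * s / 24], below the threshold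
     [s / 24] of [step_stable]. *)
  have e : 2 * (gammac + gammad) = 24 / s by rewrite /gammac /gammad; lra.
  rewrite e mulrAC ler_pdivrMr // in hZ.
  have := mulr_gt0 c00 hsigma; rewrite -/(P X Z); lra.
Qed.
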